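(* Let $R$ be a ring. Every co-semisimple $R$-module is a cl.Hilbert module.
   Context: All rings are commutative with identity $1\neq 0$ and all modules are unital. For $R$-modules $U$ and $M$, $U$ is called $M$-injective if for every submodule $N$ of $M$, each homomorphism $N\to U$ can be extended to a homomorphism $M\to U$. An $R$-module $M$ is co-semisimple if every simple $R$-module is $M$-injective. A proper submodule $P$ of an $R$-module $M$ is classical prime if for all $a,b\in R$ and $m\in M$, $abm\in P$ implies $am\in P$ or $bm\in P$. An $R$-module $M$ is a cl.Hilbert module (classical Hilbert module) if every classical prime submodule of $M$ is an intersection of maximal submodules of $M$. *)

(* Defs.v *)
From HB Require Import structures.
From mathcomp Require Import all_boot all_algebra.

Set Implicit Arguments.
Unset Strict Implicit.
Unset Printing Implicit Defensive.

Import GRing.Theory.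
Local Open Scope ring_scope.

(* Submodules of [M] are the structures [submodClosed M], compared
   extensionally (=i).  They are boolean predicates; the intended reading is
   classical, where every [Prop]-valued submodule is of this form. *)

Definition submod (R : comNzRingType) (M : lmodType R) (N : submodClosed M) :=
  {x : M | x \in N}.

HB.instance Definition _ (R : comNzRingType) (M : lmodType R)
  (N : submodClosed M) := SubChoice.on (submod N).
HB.instance Definition _ (R : comNzRingType) (M : lmodType R)
  (N : submodClosed M) := [SubChoice_isSubLmodule of submod N by <:].

Definition proper_submod (R : comNzRingType) (M : lmodType R)
    (P : submodClosed M) : Prop :=
  exists m : M, m \notin P.

Definition maximal_submod (R : comNzRingType) (M : lmodType R)
    (P : submodClosed M) : Prop :=
  proper_submod P /\
  forall N : submodClosed M,
    {subset P <= N} -> proper_submod N -> N =i P.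

Definition simple_module (R : comNzRingType) (U : lmodType R) : Prop :=
  (exists u : U, u != 0) /\
  forall N : submodClosed U, N =i pred1 (0 : U) \/ N =i predT.

Definition rel_injective (R : comNzRingType) (U M : lmodType R) : Prop :=
  forall (N : submodClosed M) (f : {linear submod N -> U}),
    exists g : {linear M -> U}, forall x : submod N, g (\val x) = f x.

Definition co_semisimple (R : comNzRingType) (M : lmodType R) : Prop :=
  forall U : lmodType R, simple_module U -> rel_injective U M.

Definition classical_prime (R : comNzRingType) (M : lmodType R)
    (P : submodClosed M) : Prop :=
  proper_submod P /\
  forall (a b : R) (m : M),
    (a * b) *: m \in P -> a *: m \in P \/ b *: m \in P.

(* The empty family has intersection [M]; this case never arises for a proper
   submodule [P]. *)
Definition intersection_of_maximal (R : comNzRingType) (M : lmodType R)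
    (P : submodClosed M) : Prop :=
  exists F : submodClosed M -> Prop,
    (forall N, F N -> maximal_submod N) /\
    forall x : M, x \in P <-> (forall N, F N -> x \in N).

Definition cl_Hilbert (R : comNzRingType) (M : lmodType R) : Prop :=
  forall P : submodClosed M, classical_prime P -> intersection_of_maximal P.

(* Main.v *)
Require Import Defs.
From HB Require Import structures.
From mathcomp Require Import all_boot all_algebra.
From mathcomp Require Import boolp classical_sets.

Set Implicit Arguments.
Unset Strict Implicit.
Unset Printing Implicit Defensive.

Import GRing.Theory.
Local Open Scope ring_scope.

(** In a co-semisimple module every submodule [P] is an intersection of maximal
    submodules.  Given [x] outside [P], choose by Zorn's lemma a submodule
    [N] containing [P] and maximal among those that avoid [x].  Then
    [(N + Rx) / N] is simple, and by relative injectivity the projection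
    [N + Rx -> (N + Rx) / N] extends to all of [M].  The kernel of this
    extension is a maximal submodule that contains [N] but not [x]. *)

(** Classical logic decides membership in [A], which turns a [Prop]-valued submodule into a boolean
    one. *)
Lemma submod_of_set (R : comNzRingType) (M : lmodType R) (A : set M) :
    A 0 -> (forall (a : R) u v, A u -> A v -> A (a *: u + v)) ->
  exists N : submodClosed M, forall m, m \in N <-> A m.
Proof.
move=> A0 Alin; pose S := fun m : M => `[< A m >].
have SP : GRing.submod_closed (S : {pred M}).
  split; first exact/asboolP.
  by move=> a u v /asboolP Au /asboolP Av; apply/asboolP/Alin.
pose S_submod := GRing.isSubmodClosed.Build R M S (GRing.submod_closed_semi SP).
pose N : submodClosed M := HB.pack S S_submod.
by exists N => m; split=> [/asboolP|Am]; last exact/asboolP.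
Qed.

Section QuotientModule.

Variables (R : comNzRingType) (V : lmodType R) (W : submodClosed V).
Local Open Scope quotient_scope.

(* [submodClosed] does not inherit from [zmodClosed], which [Quotient] needs. *)
Fact submod_oppr_closed : oppr_closed W.
Proof. by move=> v vW; rewrite -scaleN1r rpredZ. Qed.

Definition zmod_of_submod : zmodClosed V :=
  HB.pack (GRing.SubmodClosed.sort W)
    (GRing.isOppClosed.Build V (GRing.SubmodClosed.sort W) submod_oppr_closed).

Definition quotmod := Quotient.quot zmod_of_submod.
HB.instance Definition _ := EqQuotient.on quotmod.
HB.instance Definition _ := GRing.Zmodule.on quotmod.

Definition quotmod_pi (v : V) : quotmod := \pi_(Quotient.quot zmod_of_submod) v.

Lemma quotmod_piP u v : reflect (quotmod_pi u = quotmod_pi v) (u - v \in W).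
Proof. by rewrite [_ \in W](Quotient.idealrBE zmod_of_submod); exact: eqP. Qed.

Lemma quotmod_piK (q : quotmod) : quotmod_pi (repr q) = q.
Proof. exact: reprK. Qed.

Lemma quotmod_piD u v : quotmod_pi (u + v) = quotmod_pi u + quotmod_pi v.
Proof. exact: (raddfD (\pi_(Quotient.quot zmod_of_submod))). Qed.

Definition quotmod_scale (a : R) (q : quotmod) : quotmod :=
  quotmod_pi (a *: repr q).

(** Scaling does not depend on the representative: two of them differ by an element of [W], and [W]
    is stable under scaling. The module axioms then descend from [V]. *)
Lemma quotmod_scale_pi a v :
  quotmod_scale a (quotmod_pi v) = quotmod_pi (a *: v).
Proof.
apply/quotmod_piP; rewrite -scalerBr rpredZ //.
by apply/quotmod_piP; rewrite quotmod_piK.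
Qed.

Fact quotmod_scaleA a b q :
  quotmod_scale a (quotmod_scale b q) = quotmod_scale (a * b) q.
Proof. by rewrite -[q]quotmod_piK !quotmod_scale_pi scalerA. Qed.

Fact quotmod_scale1 : left_id 1 quotmod_scale.
Proof. by move=> q; rewrite -[q]quotmod_piK quotmod_scale_pi scale1r. Qed.

Fact quotmod_scaleDr : right_distributive quotmod_scale +%R.
Proof.
move=> a p q; rewrite -[p]quotmod_piK -[q]quotmod_piK -quotmod_piD.
by rewrite !quotmod_scale_pi scalerDr quotmod_piD.
Qed.

Fact quotmod_scaleDl q : {morph quotmod_scale^~ q : a b / a + b}.
Proof.
by move=> a b; rewrite -[q]quotmod_piK !quotmod_scale_pi scalerDl quotmod_piD.
Qed.

HB.instance Definition _ := GRing.Zmodule_isLmodule.Build R quotmod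
  quotmod_scaleA quotmod_scale1 quotmod_scaleDr quotmod_scaleDl.

Fact quotmod_pi_is_linear : linear quotmod_pi.
Proof.
by move=> a u v; rewrite quotmod_piD; congr (_ + _); rewrite -quotmod_scale_pi.
Qed.

HB.instance Definition _ :=
  GRing.isLinear.Build R V quotmod _ quotmod_pi quotmod_pi_is_linear.

Lemma quotmod_pi_eq0 v : (quotmod_pi v == 0) = (v \in W).
Proof.
by rewrite -[v in RHS]subr0 -(raddf0 quotmod_pi); apply/eqP/quotmod_piP.
Qed.

End QuotientModule.

(** Zorn's lemma is applied to the sets [A] whose union with [P] is a submodule avoiding [x]; for a
    maximal [A] this union is [N]. *)
Lemma exists_submod_maximal_avoiding (R : comNzRingType) (M : lmodType R)
    (P : submodClosed M) (x : M) : x \notin P ->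
  exists N : submodClosed M, [/\ {subset P <= N}, x \notin N &
    forall K : submodClosed M, {subset N <= K} -> x \notin K -> K =i N].
Proof.
move=> xP.
(* Joining [P] to every set makes the empty chain harmless in Zorn's lemma. *)
pose join (A : set M) : set M := [set m | m \in P \/ A m]%classic.
pose Z (A : set M) := ~ join A x /\
  forall (a : R) u v, join A u -> join A v -> join A (a *: u + v).
have [|A [[xA linA] maxA]] := @Zorn_bigcup M Z.
  move=> F FZ totF; split=> [[|[A FA Ax]]|a u v].
  - by rewrite (negPf xP).
  - by have [nAx _] := FZ _ FA; apply: nAx; right.
  have in_join A w : F A -> join A w -> join (\bigcup_(X in F) X)%classic w.
    by move=> FA [|Aw]; [left | right; exists A].
  move=> [uP|[A FA Au]] [vP|[B FB Bv]].
  - by left; rewrite rpredD ?rpredZ.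
  - by apply: (in_join B) => //; apply: (FZ _ FB).2; [left | right].
  - by apply: (in_join A) => //; apply: (FZ _ FA).2; [right | left].
  (* Of two members of the chain, the larger one contains both vectors. *)
  have [AB|BA] := totF _ _ FA FB.
    by apply: (in_join B) => //; apply: (FZ _ FB).2; right => //; apply: AB.
  by apply: (in_join A) => //; apply: (FZ _ FA).2; right => //; apply: BA.
have [|N NE] := submod_of_set _ linA; first by left; rewrite rpred0.
exists N; split=> [m mP||K NK xK m].
- by apply/NE; left.
- by apply/negP => /NE.
apply/idP/idP; last exact: NK.
have joinK w : join [set k | k \in K]%classic w -> w \in K.
  by case=> [wP|//]; apply/NK/NE; left.
(* Aiming at [A m] loses nothing, even for [m] in [P]: if [m] were outside [A], then [K] would be a
   strictly larger admissible set. *)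
move=> mK; apply/NE; right; apply: contrapT => mA.
apply: (maxA [set k | k \in K]%classic).
  split=> [k Ak|KA]; last exact/mA/KA.
  by apply/NK/NE; right.
split=> [/joinK|a u v /joinK uK /joinK vK]; first by rewrite (negPf xK).
by right; rewrite /= rpredD ?rpredZ.
Qed.

Lemma kernel_maximal (R : comNzRingType) (M U : lmodType R)
    (g : {linear M -> U}) (x : M) : simple_module U -> g x != 0 ->
  exists2 K : submodClosed M, maximal_submod K &
    forall m, m \in K <-> g m = 0.
Proof.
move=> [_ simpleU] gx0.
have [||K KE] := @submod_of_set R M [set m | g m = 0]%classic.
- exact: raddf0.
- by move=> a u v /= gu gv; rewrite linearP gu gv scaler0 addr0.
exists K => //; split; first by exists x; apply/negP => /KE/eqP; apply/negP.
move=> N KN [y yN].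
have [||I IE] := @submod_of_set R U [set g m | m in [set m | m \in N]]%classic.
- by exists 0; rewrite ?raddf0 //= rpred0.
- move=> a _ _ [m mN <-] [n nN <-];
    exists (a *: m + n); last by rewrite linearP.
  by rewrite /= rpredD ?rpredZ.
(* The image [I] of [N] is zero or all of [U]. If zero, [N] lies in the kernel. If all of [U], then
   [y] differs from some element of [N] by a kernel element, so [y] is in [N], a contradiction. *)
have [I0|IT] := simpleU I.
  move=> m; apply/idP/idP=> [mN|]; last exact: KN.
  by apply/KE/eqP; rewrite -[_ == 0]I0; apply/IE; exists m.
have /IE[n nN gn] : g y \in I by rewrite IT.
case/negP: yN; rewrite -[y](subrK n) rpredD //; apply/KN/KE.
by rewrite /= linearB gn subrr.
Qed.

(** This is the sum [N + Rx]; [r] is the coefficient of [x]. *)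
Lemma exists_submod_adjoin (R : comNzRingType) (M : lmodType R)
    (N : submodClosed M) (x : M) :
  exists N' : submodClosed M,
    forall m, m \in N' <-> exists r, m - r *: x \in N.
Proof.
have [||N' N'E] :=
  @submod_of_set R M [set m | exists r, m - r *: x \in N]%classic.
- by exists 0; rewrite scale0r subr0 rpred0.
- move=> a u v [r ru] [s sv]; exists (a * r + s).
  by rewrite scalerDl -scalerA opprD addrACA -scalerBr rpredD ?rpredZ.
by exists N'.
Qed.

(** Here [W] is [N] viewed inside [N'], so the quotient is [(N + Rx) / N]. A submodule [L] of it
    pulls back to a submodule [K] of [M] between [N] and [N'], to which the maximality of [N]
    applies. *)
Lemma simple_quotient_adjoin (R : comNzRingType) (M : lmodType R)
    (N N' : submodClosed M) (x : M) (W : submodClosed (submod N')) :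
    x \notin N ->
    (forall K : submodClosed M, {subset N <= K} -> x \notin K -> K =i N) ->
    (forall m, m \in N' <-> exists r, m - r *: x \in N) ->
    (forall v, v \in W <-> \val v \in N) ->
  simple_module (quotmod W).
Proof.
move=> xN maxN N'E WE.
have NN' m : m \in N -> m \in N'.
  by move=> mN; apply/N'E; exists 0; rewrite scale0r subr0.
have xN' : x \in N' by apply/N'E; exists 1; rewrite scale1r subrr rpred0.
pose x' : submod N' := exist _ x xN'.
split=> [|L].
  exists (quotmod_pi W x'); rewrite quotmod_pi_eq0.
  by apply/negP => /WE/(negP xN).
have [||K KE] := @submod_of_set R M
    [set m | exists2 v : submod N', \val v = m & quotmod_pi W v \in L]%classic.
- by exists 0; rewrite ?raddf0 ?rpred0.
- move=> a _ _ [u <- uL] [v <- vL]; exists (a *: u + v) => //.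
  by rewrite linearP rpredD ?rpredZ.
have NK m : m \in N -> m \in K.
  move=> mN; apply/KE; exists (exist _ m (NN' m mN)) => //.
  suff /eqP-> : quotmod_pi W (exist _ m (NN' m mN)) == 0 by rewrite rpred0.
  by rewrite quotmod_pi_eq0; apply/WE.
(* If [x] is in [K], then [K] contains [N + Rx] and [L] is everything; otherwise [K] equals [N] and
   [L] is zero. *)
have [xK|xK] := boolP (x \in K); [right|left] => q; rewrite -[q]quotmod_piK.
  move: (repr q) => v; rewrite [RHS]inE.
  have /KE[u uv uL] : \val v \in K.
    have /N'E[r vr] := valP v.
    by rewrite -[\val v](subrK (r *: x)) rpredD ?(NK _ vr) ?rpredZ.
  by rewrite -(val_inj uv).
move: (repr q) => v; rewrite [RHS]inE quotmod_pi_eq0.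
apply/idP/idP=> [vL|vW].
  by apply/WE; rewrite -(maxN K NK xK); apply/KE; exists v.
by move: vW; rewrite -quotmod_pi_eq0 => /eqP->; rewrite rpred0.
Qed.

Lemma co_semisimple_separation (R : comNzRingType) (M : lmodType R)
    (P : submodClosed M) (x : M) : co_semisimple M -> x \notin P ->
  exists K : submodClosed M,
    [/\ maximal_submod K, {subset P <= K} & x \notin K].
Proof.
move=> cssM /exists_submod_maximal_avoiding[N [PN xN maxN]].
have [N' N'E] := exists_submod_adjoin N x.
have [||W WE] := @submod_of_set R (submod N') [set v | \val v \in N]%classic.
- exact: rpred0.
- by move=> a u v /= uN vN; apply: rpredD => //; apply: rpredZ.
have simpleU := simple_quotient_adjoin xN maxN N'E WE.
have [g gE] := cssM _ simpleU N' (quotmod_pi W).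
have xN' : x \in N' by apply/N'E; exists 1; rewrite scale1r subrr rpred0.
(* On [N'] the extension [g] is the projection, whose kernel is [N]: it is nonzero at [x] and
   vanishes on [P]. *)
have gx0 : g x != 0.
  rewrite -[x]/(\val (exist _ x xN' : submod N')) gE quotmod_pi_eq0.
  by apply/negP => /WE/(negP xN).
have [K maxK KE] := kernel_maximal simpleU gx0.
exists K; split=> // [m /PN mN|]; last by apply/negP => /KE/eqP; apply/negP.
have mN' : m \in N' by apply/N'E; exists 0; rewrite scale0r subr0.
apply/KE/eqP; rewrite -[m]/(\val (exist _ m mN' : submod N')) gE.
by rewrite quotmod_pi_eq0; apply/WE.
Qed.

Theorem mainTheorem5 (R : comNzRingType) (M : lmodType R) :
  co_semisimple M -> cl_Hilbert M.
Proof.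
move=> cssM P _.
(* The family consists of all maximal submodules above [P]; separation excludes every point outside
   [P]. *)
exists (fun N => maximal_submod N /\ {subset P <= N}); split=> [N []//|x].
split=> [xP N [_ PN]|xF]; first exact: PN.
apply: contrapT => /negP xP.
have [K [maxK PK xK]] := co_semisimple_separation cssM xP.
by case/negP: xK; apply: xF.
Qed.
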